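(* Let $\mathcal C\subseteq\mathbb R^d$ be nonempty, compact and convex, and let $\alpha>0$ and $q\in\mathbb R$ with $q\ge2$. If $\mathcal C$ is $(\alpha,q)$-uniformly convex, then for every nonempty $M\subseteq\mathcal C$ and every LMO selector $S$ for $\mathcal C$ (that is, any fixed atom-selection rule), $\mathcal C$ together with $S$ satisfies local dual sharpness around $M$ with constants $(\alpha/2,q)$.
   Context: Norms are Euclidean. Coordinates are taken on the affine hull of $\mathcal C$; equivalently, the definitions are read relative to $\operatorname{aff}(\mathcal C)$. $(\alpha,q)$-uniform convexity: for every $x,y\in\mathcal C$, every $\lambda\in[0,1]$ and every $z\in\mathbb R^d$ with $\|z\|=1$, $$\lambda x+(1-\lambda)y+\lambda(1-\lambda)\alpha\|x-y\|^q z\in\mathcal C .$$ LMO selector: a fixed deterministic map $S\colon\mathbb R^d\to\mathcal C$ with $S(g)\in\operatorname{argmin}_{s\in\mathcal C}\langle g,s\rangle$ for every $g$. Local dual sharpness (LDS): for nonempty $M\subseteq\mathcal C$, $A>0$ and real $q\ge2$, $\mathcal C$ together with the selector $S$ satisfies local dual sharpness around $M$ with constants $(A,q)$ if there is $\rho>0$ such that for every $x\in\mathcal C$ with $\operatorname{dist}(x,M)<\rho$ and every $g\in\mathbb R^d$, $$A\|g\|\,\|x-S(g)\|^q\le\langle g,x-S(g)\rangle .$$ *)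

(* Defs.v *)
From HB Require Import structures.
From mathcomp Require Import all_boot all_order all_algebra.
From mathcomp Require Import all_classical all_reals all_analysis.

Set Implicit Arguments.
Unset Strict Implicit.
Unset Printing Implicit Defensive.

Import Order.TTheory GRing.Theory Num.Theory.
Import numFieldNormedType.Exports.

Local Open Scope classical_set_scope.
Local Open Scope ring_scope.

Section UniformConvexity.
Context {R : realType} {d : nat}.
Implicit Types (C M A : set 'rV[R]_d) (x y z g s : 'rV[R]_d) (a q lambda : R).

Definition inner x y : R := \sum_(i < d) x 0 i * y 0 i.

(* The library norm `|x| on 'rV[R]_d is the sup norm, hence this one. *)
Definition enorm x : R := Num.sqrt (inner x x).

Definition dist x M : R := inf [set enorm (x - m) | m in M].

Definition affine_set A :=
  forall x y (t : R), A x -> A y -> A (t *: x + (1 - t) *: y).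

Definition aff C : set 'rV[R]_d := smallest affine_set C.

(* The linear subspace parallel to aff C.  Reading a definition relative to
   aff C amounts to letting its vectors (directions z, linear functionals g)
   range over aff_dir C; this is the whole space when C is full-dimensional. *)
Definition aff_dir C : set 'rV[R]_d :=
  [set u | exists x y, [/\ aff C x, aff C y & u = x - y]].

Definition uniformly_convex a q C :=
  forall x y lambda z, C x -> C y -> 0 <= lambda <= 1 ->
    aff_dir C z -> enorm z = 1 ->
    C (lambda *: x + (1 - lambda) *: y
       + (lambda * (1 - lambda) * a * enorm (x - y) `^ q) *: z).

Definition argmin_inner C g : set 'rV[R]_d :=
  [set s | C s /\ forall t, C t -> inner g s <= inner g t].

(* S is a total function, but only its values on aff_dir C are constrained. *)
Definition lmo_selector C (S : 'rV[R]_d -> 'rV[R]_d) :=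
  forall g, aff_dir C g -> argmin_inner C g (S g).

Definition local_dual_sharpness C (S : 'rV[R]_d -> 'rV[R]_d) M a q :=
  exists2 rho : R, 0 < rho &
    forall x g, C x -> dist x M < rho -> aff_dir C g ->
      a * enorm g * enorm (x - S g) `^ q <= inner g (x - S g).

End UniformConvexity.

(* Main.v *)
Require Import Defs.
From HB Require Import structures.
From mathcomp Require Import all_boot all_order all_algebra.
From mathcomp Require Import all_classical all_reals all_analysis.
From mathcomp Require Import lra.

(* Compare S(g) with the midpoint of x and S(g) pushed by uniform convexity in
   the direction -g/|g|: minimality of S(g) gives
   0 <= <g, x - S(g)>/2 - alpha |g| |x - S(g)|^q / 4.
   The bound holds on all of C, so any radius around M works. *)

Set Implicit Arguments.
Unset Strict Implicit.
Unset Printing Implicit Defensive.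

Import Order.TTheory GRing.Theory Num.Theory.
Import numFieldNormedType.Exports.

Local Open Scope classical_set_scope.
Local Open Scope ring_scope.

Section Inner.
Context {R : realType} {d : nat}.
Implicit Types (x y z : 'rV[R]_d) (c : R).

Lemma innerDr x y z : inner x (y + z) = inner x y + inner x z.
Proof. by rewrite -big_split; apply: eq_bigr => i _; rewrite mxE mulrDr. Qed.

Lemma innerZr c x y : inner x (c *: y) = c * inner x y.
Proof. by rewrite mulr_sumr; apply: eq_bigr => i _; rewrite mxE mulrCA. Qed.

Lemma innerC x y : inner x y = inner y x.
Proof. by apply: eq_bigr => i _; rewrite mulrC. Qed.

Lemma innerZl c x y : inner (c *: x) y = c * inner x y.
Proof. by rewrite innerC innerZr innerC. Qed.

Lemma innerNr x y : inner x (- y) = - inner x y.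
Proof. by rewrite -scaleN1r innerZr mulN1r. Qed.

Lemma inner_ge0 x : 0 <= inner x x.
Proof. by apply: sumr_ge0 => i _; rewrite -expr2 sqr_ge0. Qed.

Lemma enorm_ge0 x : 0 <= enorm x.
Proof. exact: sqrtr_ge0. Qed.

Lemma enorm_sqr x : enorm x ^+ 2 = inner x x.
Proof. by rewrite sqr_sqrtr ?inner_ge0. Qed.

Lemma enormZ c x : enorm (c *: x) = `|c| * enorm x.
Proof.
by rewrite /enorm innerZl innerZr mulrA -expr2 sqrtrM ?sqr_ge0// sqrtr_sqr.
Qed.

Lemma enorm_eq0 x : enorm x = 0 -> x = 0.
Proof.
move=> x0; have /eqP : inner x x = 0 by rewrite -enorm_sqr x0 expr0n.
rewrite psumr_eq0 => [/allP xx0|i _]; last by rewrite -expr2 sqr_ge0.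
apply/rowP => i; rewrite mxE; apply/eqP.
by have := xx0 i (mem_index_enum i); rewrite mulf_eq0 orbb.
Qed.

(** If [x = u - v], then [c *: x] leads from [v] to a point of the line through [u] and [v], which
    stays in the hull. This makes the normalized [- g] a direction along which uniform convexity may
    push. *)
Lemma aff_dirZ (C : set 'rV[R]_d) c x : aff_dir C x -> aff_dir C (c *: x).
Proof.
move=> [u [v [Cu Cv ->]]]; exists (c *: u + (1 - c) *: v), v; split => //.
  by move=> A hA; have [affA _] := hA; exact: affA (Cu A hA) (Cv A hA).
by rewrite scalerBl scale1r scalerBr addrA addrAC addrK.
Qed.

End Inner.

Theorem proposition3p4 (R : realType) (d : nat) (C : set 'rV[R]_d)
    (alpha q : R) :
  C !=set0 -> compact C -> convex_set (C : set (convex_lmodType 'rV[R]_d)) ->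
  0 < alpha -> 2 <= q ->
  uniformly_convex alpha q C ->
  forall (M : set 'rV[R]_d) (S : 'rV[R]_d -> 'rV[R]_d),
    M !=set0 -> M `<=` C -> lmo_selector C S ->
    local_dual_sharpness C S M (alpha / 2) q.
Proof.
move=> _ _ _ _ _ ucC M S _ _ lmoS; exists 1 => // x g Cx _ dg.
have [CSg minSg] := lmoS g dg.
have [g0|g0] := eqVneq (enorm g) 0.
  (* A zero [g] cannot be normalized, but then both sides vanish; writing 0 as [0 *: 0] lets
     [innerZl] show it on the right. *)
  rewrite g0 mulr0 mul0r (enorm_eq0 g0) -[X in inner X _](scale0r (0 : 'rV[R]_d)).
  by rewrite innerZl mul0r.
pose z := - (enorm g)^-1 *: g; have dz : aff_dir C z := aff_dirZ _ dg.
have z1 : enorm z = 1 by rewrite enormZ normrN ger0_norm ?invr_ge0 ?enorm_ge0// mulVf.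
have gz : inner g z = - enorm g.
  by rewrite innerZr -enorm_sqr expr2 mulNr mulKf.
clearbody z.
(* With weight [lambda > 0] on [x], minimality of [S g] divided by [lambda] bounds
   [inner g (x - S g)] below by [(1 - lambda) * alpha * enorm g * D], where [D] is the power named
   below; the midpoint gives exactly [alpha / 2]. *)
have half01 : 0 <= (2^-1 : R) <= 1 by apply/andP; split; lra.
have := minSg _ (ucC x (S g) 2^-1 z Cx CSg half01 dz z1).
rewrite !innerDr !innerZr gz innerNr.
set D := _ `^ q.
(* The goal is twice the inequality just obtained, with [alpha * enorm g * D] treated as a single
   monomial. *)
nra.
Qed.
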